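(* Let $H\in C^2(\mathbb R^d\times\mathbb R^d;\mathbb R)$, $H=H(p,x)$, be $\mathbb Z^d$-periodic in $x$, with $D^2_{pp}H>0$ and $\lim_{|p|\to+\infty}|p|^{-1}H(p,x)=+\infty$ uniformly in $x$. Let $\zeta:\mathbb R^d\to\mathbb R$ be nonnegative, Lipschitz continuous and compactly supported. For $\eta\in(0,1)$ let $(X^\eta_k)_{k\in\mathbb Z^d}$ be i.i.d. Bernoulli random variables with $\mathbb P[X^\eta_0=1]=1-\mathbb P[X^\eta_0=0]=\eta$, set $\zeta_\eta(x)=\sum_{k\in\mathbb Z^d}X^\eta_k\,\zeta(x-k)$ and $H_\eta(p,x)=H(p,x)-\zeta_\eta(x)$, and let $\overline H$, $\overline H_\eta$ be the effective constants of $H$ and $H_\eta$. Then there exists a constant $C>0$ depending only on $\zeta$ such that $$0\le\overline H-\overline H_\eta\le C\eta\qquad\text{for all }\eta\in(0,1).$$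
   Context: Hamilton-Jacobi equations are understood in the viscosity sense. $\overline H$ is the unique constant for which $H(D\chi,x)=\overline H$ in $\mathbb R^d$ has a continuous $\mathbb Z^d$-periodic solution $\chi$. $\overline H_\eta$ is the (deterministic) almost sure limit $\overline H_\eta=\lim_{\delta\to0}-\delta v^{\eta,\delta}(0)$, where $v^{\eta,\delta}$ is the unique bounded solution of $\delta v^{\eta,\delta}+H_\eta(Dv^{\eta,\delta},x)=0$ in $\mathbb R^d$. *)

(* Defs.v *)
From HB Require Import structures.
From mathcomp Require Export all_boot all_order all_algebra.
From mathcomp Require Export finmap.
From mathcomp Require Export all_classical all_reals all_analysis.
Export Order.TTheory GRing.Theory Num.Theory.
Export numFieldNormedType.Exports.

Set Implicit Arguments.
Unset Strict Implicit.
Unset Printing Implicit Defensive.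

Local Open Scope classical_set_scope.
Local Open Scope ring_scope.

Section Calculus.
Context {R : realType}.

(* To be used on finite-dimensional spaces, where continuity of all the
   directional derivatives is equivalent to continuity of x |-> 'd f x. *)
Definition C1 (V : normedModType R) (f : V -> R) : Prop :=
  forall u : V, (forall x, derivable f x u) /\ continuous (fun x => 'D_u f x).

Definition C2 (V : normedModType R) (f : V -> R) : Prop :=
  C1 f /\ forall u : V, C1 (fun x => 'D_u f x).

Definition gradient d (f : 'rV[R]_d -> R) (x : 'rV[R]_d) : 'rV[R]_d :=
  \row_i 'D_('e_i) f x.

Definition hessian d (f : 'rV[R]_d -> R) (x : 'rV[R]_d) : 'M[R]_d :=
  \matrix_(i, j) 'D_('e_i) (fun y => 'D_('e_j) f y) x.

Definition positive_definite d (A : 'M[R]_d) : Prop :=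
  forall q : 'rV[R]_d, q != 0 -> 0 < (q *m A *m q^T) 0 0.

Definition Zd_periodic d (f : 'rV[R]_d -> R) : Prop :=
  forall (k : 'rV[int]_d) (x : 'rV[R]_d), f (x + map_mx intr k) = f x.

Definition compactly_supported d (f : 'rV[R]_d -> R) : Prop :=
  compact (closure [set x | f x != 0]).

End Calculus.

Section Viscosity.
Context {R : realType} {d : nat}.
Local Notation E := 'rV[R]_d.

(* Continuous viscosity solutions of F(u, Du, x) = 0 in the whole space; the
   arguments of F are the value, the gradient and the point, in this order. *)
Definition viscosity_subsolution (F : R -> E -> E -> R) (u : E -> R) : Prop :=
  forall (phi : E -> R) (x0 : E), C1 phi ->
    (\forall y \near x0, u y - phi y <= u x0 - phi x0) ->
    F (u x0) (gradient phi x0) x0 <= 0.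

Definition viscosity_supersolution (F : R -> E -> E -> R) (u : E -> R) : Prop :=
  forall (phi : E -> R) (x0 : E), C1 phi ->
    (\forall y \near x0, u x0 - phi x0 <= u y - phi y) ->
    0 <= F (u x0) (gradient phi x0) x0.

Definition viscosity_solution (F : R -> E -> E -> R) (u : E -> R) : Prop :=
  [/\ continuous u, viscosity_subsolution F u & viscosity_supersolution F u].

(* For the periodic, coercive Hamiltonians considered there is exactly one such c. *)
Definition effective_constant (H : E -> E -> R) (c : R) : Prop :=
  exists chi : E -> R,
    Zd_periodic chi /\ viscosity_solution (fun _ p x => H p x - c) chi.

Definition bounded_discounted_solution (H : E -> E -> R) (delta : R)
    (v : E -> R) : Prop :=
  bounded_fun v /\ viscosity_solution (fun r p x => delta * r + H p x) v.

(* For coercive Hamiltonians the bounded solution v delta is unique, so that the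
   existential over v only names it. *)
Definition random_effective_constant disp (Omega : measurableType disp)
    (P : probability Omega R) (H : Omega -> E -> E -> R) (c : R) : Prop :=
  \forall w \ae P, exists v : R -> E -> R,
    (forall delta : R, 0 < delta ->
       bounded_discounted_solution (H w) delta (v delta)) /\
    - (delta * v delta 0) @[delta --> 0^'+] --> c.

End Viscosity.

Section Randomness.
Context {R : realType} {disp : measure_display} {Omega : measurableType disp}.
Variable P : probability Omega R.

Definition mutually_independent (I : choiceType) (X : I -> {RV P >-> R}) : Prop :=
  forall (J : {fset I}) (B : I -> set R),
    (forall i, measurable (B i)) ->
    P (\bigcap_(i in [set` J]) (X i @^-1` B i)) =
    (\prod_(i <- J) P (X i @^-1` B i))%E.

Definition iid_Bernoulli d (eta : R) (X : 'rV[int]_d -> {RV P >-> R}) : Prop :=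
  [/\ mutually_independent X,
      forall (k : 'rV[int]_d) (B : set R), measurable B ->
        P (X k @^-1` B) = P (X 0 @^-1` B),
      P (X 0 @^-1` [set 1]) = eta%:E &
      P (X 0 @^-1` [set 0]) = (1 - eta)%:E].

(* For compactly supported zeta only finitely many terms are nonzero at each x,
   so that the finitely supported sum is the series over the whole lattice. *)
Definition bump_sum d (zeta : 'rV[R]_d -> R) (X : 'rV[int]_d -> {RV P >-> R})
    (w : Omega) (x : 'rV[R]_d) : R :=
  \sum_(k \in [set: 'rV[int]_d]) (X k w * zeta (x - map_mx intr k)).

End Randomness.

(* Main.v *)
(* By convexity of [H], averages of subsolutions are subsolutions.  For fixed
   [delta], average the solutions [v] of the random discounted problem over the
   configurations of the Bernoulli variables in a large finite box, one sample
   per configuration, each with the probability of its cylinder: the average is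
   a subsolution of [delta v + H(Dv, x) = eta * sum_k zeta(x - k)] in a large
   ball, and comparing it with the periodic corrector gives
   [- delta v(0) >= Hbar - C eta - o(1)] on average.  Using finitely many samples
   avoids any measurability question about [v].  If [Hbar_eta] were smaller
   than [Hbar - C eta], the cylinders on which [- delta v(0)] stays away from
   [Hbar_eta] would have probability bounded below as [delta] tends to 0, and
   their limsup would meet the almost sure set of convergence.  The other
   inequality is the comparison of [v] with the corrector, as [zeta >= 0]. *)

Require Import Defs.
From mathcomp Require Import ring lra zify.
Set Implicit Arguments.
Unset Strict Implicit.
Unset Printing Implicit Defensive.
Local Open Scope classical_set_scope.
Local Open Scope ring_scope.

(** * Directional derivatives of C1 functions *)

Section C1Functions.
Context {R : realType} {V : normedModType R}.
Implicit Types (f : V -> R) (x u v : V).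

Lemma is_derive_line f x u (t : R) : derivable f (x + t *: u) u ->
  is_derive t 1 (fun s => f (x + s *: u)) ('D_u f (x + t *: u)).
Proof.
have E : (fun h : R => h^-1 *: (f (x + (h *: 1 + t) *: u) - f (x + t *: u))) =
         (fun h : R => h^-1 *: (f (h *: u + (x + t *: u)) - f (x + t *: u))).
  apply/funext => h; congr (_ *: (f _ - _)).
  by rewrite scalerDl [h%:A]mulr1 addrCA.
move=> df; apply: DeriveDef.
  by rewrite /derivable /= E.
by rewrite /derive /= E.
Qed.

Lemma C1_derivable f u x : C1 f -> derivable f x u.
Proof. by move=> /(_ u)[]. Qed.
Arguments C1_derivable {f} u x.

Lemma C1_increment f x u : C1 f ->
  exists2 c, 0 <= c <= 1 & f (x + u) - f x = 'D_u f (x + c *: u).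
Proof.
move=> cf.
have dl t := is_derive_line (C1_derivable u (x + t *: u) cf).
have [|c] := @MVT_segment R (fun s => f (x + s *: u))
    (fun s => 'D_u f (x + s *: u)) 0 1 ler01.
- apply: derivable_within_continuous => t _.
  by have /@ex_derive := dl t.
- rewrite in_itv /= scale1r scale0r addr0 subr0 mulr1 => c01 E.
  by exists c.
Qed.

Lemma C1_deriveZ f x u (c : R) : C1 f -> 'D_(c *: u) f x = c * 'D_u f x.
Proof.
move=> cf.
have du := is_derive_line (C1_derivable u (x + (c * 0) *: u) cf).
have hc : is_derive (0:R) (1:R) (fun s : R => c * s) c.
  by apply: is_derive_eq; rewrite [_%:A]mulr1.
have d1 := is_derive1_comp du hc.
have d2 := is_derive_line (C1_derivable (c *: u) (x + 0 *: (c *: u)) cf).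
have E : (fun s => f (x + s *: u)) \o (fun s : R => c * s) =
         (fun s => f (x + s *: (c *: u))).
  by apply/funext => s /=; rewrite scalerA mulrC.
rewrite E in d1.
move: (@derive_val _ _ _ _ _ _ _ d1) (@derive_val _ _ _ _ _ _ _ d2) => -> .
by rewrite mulr0 !scale0r addr0 mulrC => ->.
Qed.

(** Directional differentiability alone would not give additivity. The increment along [h *: v]
    starts at the moving point [h *: u + x]; the mean value theorem turns it into ['D_v f] at a
    point close to [x], and continuity of ['D_v f] concludes. *)
Lemma C1_deriveD f x u v : C1 f -> 'D_(u + v) f x = 'D_u f x + 'D_v f x.
Proof.
move=> cf; apply: cvg_lim => //=.
have cu : (fun h : R => h^-1 *: (f (h *: u + x) - f x)) @ 0^' --> 'D_u f x.
  exact: (C1_derivable u x cf).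
have cv : (fun h : R => h^-1 *: (f (h *: (u + v) + x) - f (h *: u + x)))
    @ 0^' --> 'D_v f x.
  have /cvgrPdist_lt Dv := (cf v).2 x.
  apply/cvgrPdist_lt => e e0.
  have /nbhs_ballP[r /= r0 Hr] := Dv e e0.
  near=> h.
  have h0 : h != 0 by near: h; exact: nbhs_dnbhs_neq.
  have [c c01] := C1_increment (h *: u + x) (h *: v) cf.
  rewrite C1_deriveZ// => E.
  rewrite (scalerDr h u v) (addrAC (h *: u)) E.
  rewrite -[_ *: (_ * _)]/(_ * (_ * _)) mulKf//; apply: Hr.
  rewrite -ball_normE /= (addrC (h *: u)) -addrA opprD addrA subrr sub0r normrN.
  rewrite (le_lt_trans (ler_normD _ _))// !normrZ.
  have [c0 c1] := andP c01.
  have hs : `|h| < r / (`|u| + `|v| + 1).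
    near: h; apply: dnbhs0_lt; rewrite divr_gt0// ltr_wpDl//.
  have : `|h| * (`|u| + `|v| + 1) < r.
    by rewrite -ltr_pdivlMr// ltr_wpDl// addr_ge0.
  apply: le_lt_trans; rewrite !mulrDr mulr1.
  have : `|c| * (`|h| * `|v|) <= `|h| * `|v|.
    by rewrite ler_piMl// ?mulr_ge0// ger0_norm.
  have := normr_ge0 h; lra.
rewrite [X in _ --> X]addrC.
apply: cvg_trans (cvgD cv cu); apply: near_eq_cvg; near=> h => /=.
by rewrite !fctE -scalerDr addrA subrK.
Unshelve. all: by end_near. Qed.

Lemma C1_derive_sum f x (I : Type) (r : seq I) (c : I -> R) (e : I -> V) :
  C1 f -> 'D_(\sum_(i <- r) c i *: e i) f x = \sum_(i <- r) c i * 'D_(e i) f x.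
Proof.
move=> cf; elim: r => [|i r IH]; first by rewrite !big_nil derive0.
by rewrite !big_cons C1_deriveD// IH C1_deriveZ.
Qed.

End C1Functions.

Section Slices.
Context {R : realType} {V W : normedModType R}.
Implicit Types (F : V * W -> R).

Let pair_shift (h : R) (u p : V) (x : W) :
  (h *: u + p, x) = h *: (u, 0) + (p, x).
Proof. by rewrite -[RHS]/(h *: u + p, h *: 0 + x) scaler0 add0r. Qed.

Lemma derive_slice F u (x : W) :
  'D_u (fun p => F (p, x)) = fun p => 'D_(u, 0) F (p, x).
Proof.
apply/funext => p; rewrite /derive; set g' := (X in lim (X @ _)).
set g := (X in _ = lim (X @ _)); suff -> : g' = g by [].
apply/funext => h; rewrite /g' /g /=; congr (_ *: (F _ - _)).
exact: pair_shift.
Qed.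

Lemma C1_slice F (x : W) : C1 F -> C1 (fun p => F (p, x)).
Proof.
move=> cF u; split; last first.
  rewrite derive_slice => p.
  have := (cF (u, 0)).2 (p, x); apply: (@cvg_comp _ _ _ (fun p => (p, x))).
  by apply: cvg_pair => //=; exact: cvg_cst.
move=> p; have := (cF (u, 0)).1 (p, x).
rewrite /derivable; set g := (X in cvg (X @ _)) => cg.
set g' := (X in cvg (X @ _)); suff -> : g' = g by [].
apply/funext => h; rewrite /g' /g /=; congr (_ *: (F _ - _)).
exact: pair_shift.
Qed.

Lemma C2_slice F (x : W) : C2 F -> C2 (fun p => F (p, x)).
Proof.
move=> [cF cDF]; split; first exact: C1_slice.
move=> u; rewrite derive_slice; exact: (C1_slice x (cDF (u, 0))).
Qed.

End Slices.

(** * Jensen's inequality from a positive definite Hessian *)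

Section Convexity.
Context {R : realType} {d : nat}.
Variable f : 'rV[R]_d -> R.
Hypotheses (Cf : C2 f) (pf : forall x, positive_definite (hessian f x)).

Lemma derive2_hessian (u x : 'rV[R]_d) :
  'D_u ('D_u f) x = (u *m hessian f x *m u^T) 0 0.
Proof.
have DE : 'D_u f = \sum_(j < d) (u 0 j \*: 'D_('e_j) f).
  apply/funext => y.
  rewrite {1}(row_sum_delta u) (C1_derive_sum _ _ _ _ Cf.1).
  by rewrite fct_sumE.
transitivity ('D_(\sum_(j < d) u 0 j *: 'e_j) ('D_u f) x).
  by rewrite -row_sum_delta.
rewrite (C1_derive_sum _ _ _ _ (Cf.2 u)).
rewrite -mulmxA !mxE; apply: eq_bigr => i _; congr (_ * _).
rewrite !mxE DE.
have dj (j : 'I_d) : derivable ('D_'e_j f) x 'e_i by exact: C1_derivable (Cf.2 _).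
rewrite derive_sum; last by move=> j; exact: derivableZ.
by apply: eq_bigr => j _; rewrite deriveZ// !mxE mulrC.
Qed.

(** Two uses of the mean value theorem: the first writes the increment of [f] as ['D_v f] at a point
    of the segment, the second compares this slope with the one at [p], the difference being a
    nonnegative multiple of a second derivative along [v]. *)
Lemma tangent_le (p q : 'rV[R]_d) : f p + 'D_(q - p) f p <= f q.
Proof.
set v := q - p.
have [c /andP[c0 c1] E1] := C1_increment p v Cf.1.
have [c' _ E2] := C1_increment p (c *: v) (Cf.2 v).
have pq : p + v = q by rewrite /v addrC subrK.
suff : 0 <= 'D_v f (p + c *: v) - 'D_v f p by rewrite pq in E1; lra.
rewrite E2 (C1_deriveZ _ _ _ (Cf.2 v)) mulr_ge0// derive2_hessian.
have [->|v0] := eqVneq v 0; first by rewrite !mul0mx mxE.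
exact/ltW/pf.
Qed.

(** Average the tangent inequalities at the barycentre [m]: the linear terms cancel, because the
    weighted sum of the [P i - m] vanishes. *)
Lemma jensen (I : finType) (w : I -> R) (P : I -> 'rV[R]_d) :
  (forall i, 0 <= w i) -> \sum_i w i = 1 ->
  f (\sum_i w i *: P i) <= \sum_i w i * f (P i).
Proof.
move=> w0 w1; set m := \sum_i w i *: P i.
have -> : f m = \sum_i w i * (f m + 'D_(P i - m) f m).
  under eq_bigr do rewrite mulrDr.
  rewrite big_split /= -mulr_suml w1 mul1r -(C1_derive_sum _ _ _ _ Cf.1).
  under [X in 'D_X _ _]eq_bigr do rewrite scalerBr.
  by rewrite sumrB -scaler_suml w1 scale1r subrr derive0 addr0.
by apply: ler_sum => i _; rewrite ler_wpM2l// tangent_le.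
Qed.

End Convexity.

(** * Sup norm, compact balls and lattice translations *)

Section RowVectors.
Context {R : realType} {d : nat}.
Implicit Types x y : 'rV[R]_d.

Lemma coord_le_norm x i : `|x 0 i| <= `|x|.
Proof.
rewrite [leRHS]/Num.norm /= mx_normrE.
by apply/bigmax_geP; right => /=; exists (0, i).
Qed.

Lemma norm_rV_le x (M : R) : 0 <= M -> (forall i, `|x 0 i| <= M) -> `|x| <= M.
Proof.
move=> M0 xM; rewrite [leLHS]/Num.norm /= mx_normrE.
by apply/bigmax_leP; split => // -[i j] _ /=; rewrite ord1.
Qed.

Lemma compact_norm_le (M : R) : compact [set x : 'rV[R]_d | `|x| <= M].
Proof.
apply: bounded_closed_compact.
  exists M; split; first exact: num_real.
  by move=> N MN x /= xM; rewrite (le_trans xM)// ltW.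
rewrite (_ : mkset _ = (fun x : 'rV[R]_d => `|x|) @^-1` [set y | y <= M])//.
by apply: closed_comp => [x _|]; [exact: norm_continuous|exact: closed_le].
Qed.

Lemma lattice_translate x : exists k : 'rV[int]_d, `|x + map_mx intr k| <= 1.
Proof.
exists (\row_i - Num.floor (x 0 i)); apply: norm_rV_le => // i.
rewrite !mxE intrN ler_norml.
have := floor_itv (x 0 i); rewrite intrD mulr1z => /andP[]; lra.
Qed.

Lemma periodic_bounded (f : 'rV[R]_d -> R) : continuous f -> Zd_periodic f ->
  exists M : R, forall x, `|f x| <= M.
Proof.
move=> cf pf.
have [||c _ fc] := @compact_EVT_max _ R (fun x => `|f x|) _ _
    (@compact_norm_le 1).
- by exists 0; rewrite /= normr0.
- apply: continuous_subspaceT => x.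
  by apply: continuous_comp; [exact: cf|exact: norm_continuous].
exists `|f c| => x; have [k xk] := lattice_translate x.
by rewrite -(pf k x); apply: fc; rewrite inE.
Qed.

End RowVectors.

Section PeriodicLipschitz.
Context {R : realType} {d : nat}.
Local Notation E := 'rV[R]_d.
Variable H : E -> E -> R.
Let F (z : E * E) := H z.1 z.2.
Hypotheses (cF : C1 F) (pH : forall p, Zd_periodic (H p)).

(** Radius 2 in [x] covers the segment between two points at distance at most 1, one of which lies
    in the unit ball. *)
Lemma directional_bound (K : R) (v : E * E) :
  exists M : R, forall p x : E, `|p| <= K -> `|x| <= 2 -> `|'D_v F (p, x)| <= M.
Proof.
have cK : compact ([set p : E | `|p| <= K] `*` [set x : E | `|x| <= 2]).
  by apply: compact_setX; exact: compact_norm_le.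
have [K0|K0] := leP 0 K; last first.
  by exists 0 => p x pK; have := normr_ge0 p; lra.
have [||c _ fc] := @compact_EVT_max _ R (fun z => `|'D_v F z|) _ _ cK.
- by exists (0, 0); split; rewrite /= normr0.
- apply: continuous_subspaceT => z.
  exact: cvg_norm ((cF v).2 z).
by exists `|'D_v F c| => p x pK xK; apply: fc; rewrite inE.
Qed.

Lemma derive_coord (v w : E) z : 'D_(v, w) F z =
  \sum_j v 0 j * 'D_('e_j, 0) F z + \sum_j w 0 j * 'D_(0, 'e_j) F z.
Proof.
have -> : (v, w) = \sum_j v 0 j *: ('e_j : E, 0 : E) +
                   \sum_j w 0 j *: (0 : E, 'e_j : E).
  have sum_pair (r : seq 'I_d) (a b : 'I_d -> E) :
      \sum_(j <- r) (a j, b j) = (\sum_(j <- r) a j, \sum_(j <- r) b j).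
    by elim: r => [|j r IH]; rewrite ?big_nil// !big_cons IH.
  have vE := sum_pair (index_enum 'I_d)
    (fun j => v 0 j *: 'e_j) (fun j => v 0 j *: 0).
  have wE := sum_pair (index_enum 'I_d)
    (fun j => w 0 j *: 0) (fun j => w 0 j *: 'e_j).
  rewrite [X in X + _]vE [X in _ + X]wE -!row_sum_delta.
  rewrite -!scaler_suml !scaler0.
  by rewrite -[RHS]/(v + 0, 0 + w) addr0 add0r.
by rewrite (C1_deriveD _ _ _ cF) !(C1_derive_sum _ _ _ _ cF).
Qed.

(** The constant sums bounds on the partial derivatives over a compact set. It is uniform in space
    because one lattice translation, applied to both [x] and [y], brings them near the origin
    without changing [H]. *)
Lemma periodic_lipschitz (K : R) : exists2 L : R, 0 <= L &
  forall p q x y : E, `|p| <= K -> `|q| <= K -> `|x - y| <= 1 ->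
    H p x - H q y <= L * (`|p - q| + `|x - y|).
Proof.
have /choice[M HM] := directional_bound K.
pose S := \sum_j `|M ('e_j, 0)| + \sum_j `|M (0, 'e_j)|.
have S0 : 0 <= S by rewrite addr_ge0// sumr_ge0.
exists S => // p q x y pK qK xy.
have [k xk] := lattice_translate x.
rewrite -(pH p k x) -(pH q k y).
have -> : x - y = x + map_mx intr k - (y + map_mx intr k).
  by rewrite opprD addrACA subrr addr0.
have : `|(x + map_mx intr k) - (y + map_mx intr k)| <= 1.
  by rewrite opprD addrACA subrr addr0.
move: (x + _) (y + _) xk => {}x {}y xk {}xy {k}.
have [c /andP[c0 c1]] := C1_increment (q, y) (p - q, x - y) cF.
have -> : (q, y) + (p - q, x - y) = (p, x).
  by congr pair; rewrite /= addrC subrK.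
rewrite /F /= => ->.
set z := (X in 'D_(_) _ X).
have z1 : `|z.1| <= K.
  have -> : z.1 = (1 - c) *: q + c *: p.
    by apply/rowP => i; rewrite !mxE; ring.
  rewrite (le_trans (ler_normD _ _))// !normrZ !ger0_norm ?subr_ge0//.
  by rewrite -subr_ge0; nra.
have z2 : `|z.2| <= 2.
  have -> : z.2 = x - (1 - c) *: (x - y).
    by apply/rowP => i; rewrite !mxE; ring.
  rewrite (le_trans (ler_normB _ _))// normrZ ger0_norm ?subr_ge0//.
  have := normr_ge0 (x - y); nra.
rewrite derive_coord.
have bnd (v : E) (e : 'I_d -> E * E) :
    \sum_j v 0 j * 'D_(e j) F z <= `|v| * \sum_j `|M (e j)|.
  rewrite mulr_sumr ler_sum// => j _.
  rewrite (le_trans (ler_norm _))// normrM ler_pM// ?coord_le_norm//.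
  have := HM (e j) z.1 z.2 z1 z2; rewrite -surjective_pairing => h.
  exact: le_trans h (ler_norm _).
have := bnd (p - q) (fun j => ('e_j, 0)).
have := bnd (x - y) (fun j => (0, 'e_j)).
rewrite /S /=.
have h1 : 0 <= \sum_j `|M (('e_j : E), 0)| by rewrite sumr_ge0.
have h2 : 0 <= \sum_j `|M ((0 : E), 'e_j)| by rewrite sumr_ge0.
have := normr_ge0 (p - q); have := normr_ge0 (x - y).
nra.
Qed.

End PeriodicLipschitz.

(** * Penalisation and doubling of variables *)

Section RealValuedContinuity.
Context {R : realType} {T : topologicalType}.
Implicit Types f g : T -> R.

Lemma continuous_mul f g :
  continuous f -> continuous g -> continuous (fun x => f x * g x).
Proof. by move=> cf cg x; exact: continuousM (cf x) (cg x). Qed.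

Lemma continuous_add f g :
  continuous f -> continuous g -> continuous (fun x => f x + g x).
Proof. by move=> cf cg x; exact: continuousD (cf x) (cg x). Qed.

Lemma continuous_opp f : continuous f -> continuous (fun x => - f x).
Proof. by move=> cf x; exact: continuousN (cf x). Qed.

Lemma continuous_sum (I : Type) (r : seq I) (F : I -> T -> R) :
  (forall i, continuous (F i)) -> continuous (fun x => \sum_(i <- r) F i x).
Proof.
by move=> cF; apply: (continuous_big (op := +%R)) => //; exact: add_continuous.
Qed.

End RealValuedContinuity.

Section Quadratic.
Context {R : realType} {d : nat}.
Local Notation E := 'rV[R]_d.
Implicit Types x y u : E.

(* The norm of ['rV[R]_d] is the sup norm, which is not differentiable. *)
Definition sqnorm x : R := \sum_j x 0 j ^+ 2.

Lemma sqnorm_ge0 x : 0 <= sqnorm x.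
Proof. by apply: sumr_ge0 => j _; exact: sqr_ge0. Qed.

Lemma sqnorm0 : sqnorm 0 = 0.
Proof. by apply: big1 => j _; rewrite mxE expr0n. Qed.

Lemma normsq_le_sqnorm x : `|x| ^+ 2 <= sqnorm x.
Proof.
rewrite -[leRHS]sqr_sqrtr ?sqnorm_ge0// ler_sqr ?nnegrE ?sqrtr_ge0//.
apply: norm_rV_le => [|j]; first exact: sqrtr_ge0.
rewrite -sqrtr_sqr ler_wsqrtr// /sqnorm (bigD1 j)//= lerDl.
by apply: sumr_ge0 => i _; exact: sqr_ge0.
Qed.

Lemma norm_le_sqnorm x : `|x| <= 1 + sqnorm x.
Proof.
have := normsq_le_sqnorm x; have := normr_ge0 x.
have : 0 <= (`|x| - 1) ^+ 2 by exact: sqr_ge0.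
nra.
Qed.

Lemma sqnorm_continuous : continuous sqnorm.
Proof.
by apply: continuous_sum => j; apply: continuous_mul; exact: coord_continuous.
Qed.

(** A single family of test functions for both sides of the doubling: coefficients of either sign,
    centres [c.2]. *)
Definition quad (s : seq (R * E)) y : R := \sum_(c <- s) c.1 * sqnorm (y - c.2).

Lemma is_derive_sqnorm a x u :
  is_derive x u (fun y => sqnorm (y - a)) (2 * \sum_j (x - a) 0 j * u 0 j).
Proof.
have dc (j : 'I_d) : is_derive x u (fun y : E => (y - a) 0 j) (u 0 j).
  have L : (fun h : R => h^-1 *: ((h *: u + x - a) 0 j - (x - a) 0 j)) @ 0^'
      --> u 0 j.
    apply: cvg_near_cst; near=> h.
    have h0 : h != 0 by near: h; exact: nbhs_dnbhs_neq.
    by rewrite !mxE -[LHS]/(_ * _); field.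
  by apply: DeriveDef; [apply/cvg_ex; exists (u 0 j)|apply: cvg_lim].
have -> : (fun y => sqnorm (y - a)) = \sum_j (fun y : E => (y - a) 0 j) ^+ 2.
  by apply/funext => y; rewrite fct_sumE.
apply: is_derive_eq; rewrite mulr_sumr; apply: eq_bigr => j _.
by rewrite expr1 -[LHS]/(_ * _) mulrA.
Unshelve. all: by end_near. Qed.

Lemma is_derive_quad s x u :
  is_derive x u (quad s) (\sum_(c <- s) c.1 * (2 * \sum_j (x - c.2) 0 j * u 0 j)).
Proof.
rewrite /quad; elim: s => [|c s IH].
  under eq_fun do rewrite big_nil; rewrite big_nil; exact: is_derive_cst.
rewrite (_ : (fun y => _) = (c.1 \*: (fun y => sqnorm (y - c.2))) +
    (fun y => \sum_(c <- s) c.1 * sqnorm (y - c.2))); last first.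
  by apply/funext => y; rewrite big_cons.
rewrite big_cons; apply: is_deriveD; apply: is_deriveZ.
exact: is_derive_sqnorm.
Qed.

Lemma C1_quad s : C1 (quad s).
Proof.
move=> u; split=> [x|]; first by have /@ex_derive := is_derive_quad s x u.
rewrite (_ : (fun x => _) = fun x =>
   (\sum_(c <- s) c.1 * (2 * \sum_j (x - c.2) 0 j * u 0 j))); last first.
  by apply/funext => x; have /@derive_val := is_derive_quad s x u.
apply: continuous_sum => c; apply: continuous_mul; first exact: cst_continuous.
apply: continuous_mul; first exact: cst_continuous.
apply: continuous_sum => j; apply: continuous_mul; last exact: cst_continuous.
under eq_fun do rewrite mxE.
by apply: continuous_add; [exact: coord_continuous|exact: cst_continuous].
Qed.

Lemma gradient_quad s x :
  gradient (quad s) x = \sum_(c <- s) (2 * c.1) *: (x - c.2).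
Proof.
apply/rowP => i; rewrite mxE (derive_val (is_derive := is_derive_quad s x 'e_i)).
rewrite summxE; apply: eq_bigr => c _; rewrite mulrCA mulrA !mxE.
congr (_ * _); rewrite (bigD1 i)//= !mxE !eqxx mulr1 big1 ?addr0// => j ji.
by rewrite !mxE eqxx (negbTE ji) mulr0.
Qed.

End Quadratic.

(** * Doubling of variables for a finite family of subsolutions *)

Section Doubling.
Context {R : realType} {d : nat} {I : finType}.
Local Notation E := 'rV[R]_d.
Variables (p : I -> R) (u : I -> E -> R) (w : E -> R).
Variables (F : I -> R -> E -> E -> R) (G : R -> E -> E -> R).
Hypotheses (p_gt0 : forall i, 0 < p i) (p_sum1 : \sum_i p i = 1).
Hypotheses (cu : forall i, continuous (u i)) (cw : continuous w).
Hypothesis subu : forall i, viscosity_subsolution (F i) (u i).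
Hypothesis supw : viscosity_supersolution G w.
Variables (k b A : R) (z : E).
Hypotheses (k_gt0 : 0 < k) (b_gt0 : 0 < b).
Hypothesis osc : forall i x y, u i x - u i z + (w z - w y) <= A.

Let T := prod_topology (fun _ : I => E).

(** Each subsolution has its own variable [X i], all tied to the single variable [y] of the
    supersolution; the last term keeps [y] near [z]. *)
Let Phi (X : I -> E) (y : E) : R :=
  \sum_i p i * (u i (X i) - k * sqnorm (X i - y)) - w y - b * sqnorm (y - z).

Let Phi_continuous : continuous (fun c : T * E => Phi c.1 c.2).
Proof.
have cX i : continuous (fun c : T * E => c.1 i).
  move=> c; apply: (@continuous_comp (T * E)%type T E fst (fun X => X i) c).
    exact: cvg_fst.
  exact: (@proj_continuous I (fun=> E) i).
have cy : continuous (@snd T E) by move=> c; exact: cvg_snd.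
have csub (f g : T * E -> E) : continuous f -> continuous g ->
    continuous (fun c => sqnorm (f c - g c)).
  move=> cf cg c; apply: (@continuous_comp _ _ _ (fun c => f c - g c) sqnorm).
    exact: continuousB (cf c) (cg c).
  exact: sqnorm_continuous.
apply: continuous_add.
  apply: continuous_add.
    apply: continuous_sum => i; apply: continuous_mul; first exact: cst_continuous.
    apply: continuous_add.
      by move=> c; apply: (@continuous_comp _ _ _ (fun c : T * E => c.1 i) (u i));
        [exact: cX|exact: cu].
    apply: continuous_opp; apply: continuous_mul; first exact: cst_continuous.
    exact: csub.
  apply: continuous_opp => c.
  by apply: (@continuous_comp _ _ _ snd w); [exact: cy|exact: cw].
apply: continuous_opp; apply: continuous_mul; first exact: cst_continuous.
by apply: csub => //; exact: cst_continuous.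
Qed.

Let Phi_diag : Phi (fun=> z) z = \sum_i p i * u i z - w z.
Proof.
rewrite /Phi subrr sqnorm0 !mulr0 subr0; congr (_ - _).
by apply: eq_bigr => i _; rewrite subr0.
Qed.

Let penalty_ge0 (P : pred I) (X : I -> E) y :
  0 <= \sum_(i | P i) p i * (k * sqnorm (X i - y)).
Proof. by apply: sumr_ge0 => i _; rewrite !mulr_ge0 ?sqnorm_ge0 ?ltW. Qed.

Let bsq_ge0 y : 0 <= b * sqnorm (y - z).
Proof. by rewrite mulr_ge0 ?sqnorm_ge0 ?ltW. Qed.

(** A point at least as good as the diagonal one gains at most [A] from the oscillations, so its
    penalties cannot exceed [A]. *)
Let Phi_large X y : Phi (fun=> z) z <= Phi X y ->
  \sum_i p i * (k * sqnorm (X i - y)) + b * sqnorm (y - z) <= A.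
Proof.
rewrite Phi_diag /Phi.
under [X in _ <= X - _ - _]eq_bigr do rewrite mulrBr.
rewrite sumrB.
have : \sum_i p i * (u i (X i) - u i z + (w z - w y)) <= A.
  rewrite -[leRHS]mul1r -p_sum1 mulr_suml.
  by apply: ler_sum => i _; rewrite ler_wpM2l// ltW.
under eq_bigr do rewrite mulrDr mulrBr.
rewrite big_split /= sumrB -mulr_suml p_sum1; lra.
Qed.

(** By [Phi_large] the points that compete with the diagonal one lie in a product of balls, compact
    by Tychonoff's theorem; [T] carries the product topology for this reason. *)
Let Phi_max : exists X y, forall X' y', Phi X' y' <= Phi X y.
Proof.
pose ry := `|z| + 1 + A / b.
pose rX i := ry + 1 + A / (p i * k).
have cK : compact ([set X : T | forall i, [set x : E | `|x| <= rX i] (X i)]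
    `*` [set y : E | `|y| <= ry]).
  apply: compact_setX; last exact: compact_norm_le.
  apply: (@tychonoff I (fun=> E) (fun i => [set x : E | `|x| <= rX i])) => i.
  exact: compact_norm_le.
have A0 : 0 <= A.
  apply: le_trans (@Phi_large (fun=> z) z (lexx _)).
  exact: addr_ge0.
have ry0 : `|z| <= ry.
  by rewrite /ry -addrA lerDl addr_ge0// divr_ge0// ltW.
have large X y : Phi (fun=> z) z <= Phi X y ->
    (forall i, `|X i| <= rX i) /\ `|y| <= ry.
  move=> /Phi_large PA.
  have sX := penalty_ge0 predT X y.
  have yr : `|y| <= ry.
    have : sqnorm (y - z) <= A / b by rewrite ler_pdivlMr// mulrC; lra.
    have := norm_le_sqnorm (y - z); have := ler_normD (y - z) z.
    by rewrite subrK /ry; lra.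
  split=> // i.
  have : sqnorm (X i - y) <= A / (p i * k).
    rewrite ler_pdivlMr ?mulr_gt0// mulrC -mulrA.
    apply: le_trans PA; rewrite (bigD1 i)//= -addrA lerDl.
    exact: addr_ge0.
  have := norm_le_sqnorm (X i - y); have := ler_normD (X i - y) y.
  by rewrite subrK /rX; lra.
have [||c _ fc] := @compact_EVT_max _ R (fun c : T * E => Phi c.1 c.2) _ _ cK.
- exists ((fun=> z) : T, z); split=> //= i.
  rewrite (le_trans ry0)// /rX -addrA lerDl addr_ge0// divr_ge0// ltW//.
  by rewrite mulr_gt0.
- exact: continuous_subspaceT Phi_continuous.
exists c.1, c.2 => X y.
have zc : Phi (fun=> z) z <= Phi c.1 c.2.
  apply: (fc ((fun=> z) : T, z)); rewrite inE; split=> //= i.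
  rewrite (le_trans ry0)// /rX -addrA lerDl addr_ge0// divr_ge0// ltW//.
  by rewrite mulr_gt0.
have [zX|/ltW Xz] := leP (Phi (fun=> z) z) (Phi X y); last exact: le_trans Xz zc.
by have [h1 h2] := large _ _ zX; apply: (fc (X : T, y)); rewrite inE.
Qed.

(* The penalisations pair each [X i] with [y] only, so that the gradients at
   [X i], averaged with the weights [p i], add up to the gradient at [y]. *)
Lemma doubling : exists (X : I -> E) (y : E), [/\
  forall i, F i (u i (X i)) ((2 * k) *: (X i - y)) (X i) <= 0,
  0 <= G (w y) (\sum_i p i *: ((2 * k) *: (X i - y)) - (2 * b) *: (y - z)) y &
  \sum_i p i * u i z - w z + b * sqnorm (y - z) <=
  \sum_i p i * u i (X i) - w y].
Proof.
have [X [y max]] := Phi_max; exists X, y; split.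
- move=> i; have -> : (2 * k) *: (X i - y) = gradient (quad [:: (k, y)]) (X i).
    by rewrite gradient_quad big_cons big_nil addr0.
  apply: subu; first exact: C1_quad.
  near=> x; rewrite /quad !big_cons !big_nil !addr0 /=.
  (* Only the [i]-th variable moves, and the positive weight [p i] is divided out at the end. *)
  have := max (fun j => if j == i then x else X j) y.
  rewrite /Phi (bigD1 i)//= eqxx [X in _ <= X - _ - _](bigD1 i)//=.
  rewrite [X in _ + X - _ - _ <= _](eq_bigr (fun j =>
    p j * (u j (X j) - k * sqnorm (X j - y)))); last first.
    by move=> j /negbTE ->.
  have := p_gt0 i => pi h.
  rewrite -(ler_pM2l pi); lra.
(* As a function of [y], the test function touching [w] from below is minus the sum of all
   penalties. *)
- set s := (- b, z) :: [seq (- (p i * k), X i) | i <- index_enum I].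
  have -> : \sum_i p i *: ((2 * k) *: (X i - y)) - (2 * b) *: (y - z) =
      gradient (quad s) y.
    rewrite gradient_quad big_cons big_map /= addrC mulrN scaleNr; congr (_ + _).
    apply: eq_bigr => i _; apply/rowP => j; rewrite !mxE; ring.
  apply: supw; first exact: C1_quad.
  near=> x; have := max X x.
  rewrite /Phi /quad !big_cons !big_map /=.
  have E t : \sum_i p i * (u i (X i) - k * sqnorm (X i - t)) =
     \sum_i p i * u i (X i) + \sum_i - (p i * k) * sqnorm (t - X i).
    rewrite -big_split /=; apply: eq_bigr => i _.
    rewrite (_ : sqnorm (t - X i) = sqnorm (X i - t)); first by ring.
    by apply: eq_bigr => j _; rewrite !mxE; ring.
  by rewrite !E; lra.
- have := max (fun=> z) z; rewrite Phi_diag.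
  rewrite /Phi; under [X in _ <= X - _ - _ -> _]eq_bigr do rewrite mulrBr.
  rewrite sumrB.
  have := penalty_ge0 predT X y; lra.
Unshelve. all: by end_near. Qed.

End Doubling.

Section Comparison.
Context {R : realType} {d : nat} {I : finType}.
Local Notation E := 'rV[R]_d.
Variables (p : I -> R) (H : E -> E -> R) (K L : R).
Hypotheses (p_gt0 : forall i, 0 < p i) (p_sum1 : \sum_i p i = 1).
Hypothesis H_jensen : forall (P : I -> E) x,
  H (\sum_i p i *: P i) x <= \sum_i p i * H (P i) x.
Hypotheses (K_ge0 : 0 <= K) (L_ge0 : 0 <= L).
Hypothesis H_lip : forall P Q x y, `|P| <= K + 1 -> `|Q| <= K + 1 ->
  `|x - y| <= 1 -> H P x - H Q y <= L * (`|P - Q| + `|x - y|).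
Variables (u : I -> E -> R) (f : I -> E -> R) (a : R).
Variables (w : E -> R) (g c : R).
Hypotheses (cu : forall i, continuous (u i)) (cw : continuous w).
Hypothesis subu :
  forall i, viscosity_subsolution (fun r P x => a * r + (H P x - f i x)) (u i).
Hypothesis coercu :
  forall i P x, a * u i x + (H P x - f i x) <= 0 -> `|P| <= K.
Hypothesis supw :
  viscosity_supersolution (fun r P x => c * r + (H P x - g)) w.

Lemma comparison (z : E) (t b A : R) : 0 < t <= 1 -> 0 < b ->
  4 * (b * A) <= t ^+ 2 ->
  (forall i x y, u i x - u i z + (w z - w y) <= A) ->
  exists (X : I -> E) (y : E), [/\ forall i, `|X i - y| <= t,
    b * `|y - z| ^+ 2 <= A,
    \sum_i p i * u i z - w z <= \sum_i p i * u i (X i) - w y &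
    a * \sum_i p i * u i (X i) - c * w y <=
      \sum_i p i * f i (X i) - g + 2 * L * t].
Proof.
move=> /andP[t0 t1] b0 bA osc.
(* With this [k], a gradient of norm at most [K] gives [|X i - y| <= K * t / (K + 1)]. *)
pose k := (K + 1) / (2 * t).
have k0 : 0 < k by rewrite divr_gt0 ?ltr_wpDl// mulr_gt0.
have k20 : 0 < 2 * k by rewrite mulr_gt0.
have [X [y [subX supy val]]] :=
  doubling p_gt0 p_sum1 cu cw subu supw k0 b0 osc.
pose P i := (2 * k) *: (X i - y).
have PK i : `|P i| <= K by apply: coercu (subX i).
have Xy i : `|X i - y| <= t.
  have := PK i; rewrite /P normrZ gtr0_norm// /k => h.
  have {}h : (K + 1) * `|X i - y| <= K * t.
    have -> : (K + 1) * `|X i - y| = 2 * ((K + 1) / (2 * t)) * `|X i - y| * t.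
      by field; rewrite gt_eqF.
    by rewrite ler_wpM2r// ltW.
  have K1 : 0 < K + 1 by rewrite ltr_wpDl.
  by rewrite -(ler_pM2l K1); lra.
have sz := sqnorm_ge0 (y - z).
have nz := normsq_le_sqnorm (y - z).
have valz : \sum_i p i * u i z - w z <= \sum_i p i * u i (X i) - w y.
  have : 0 <= b * sqnorm (y - z) by rewrite mulr_ge0// ltW.
  lra.
have bsq : b * sqnorm (y - z) <= A.
  have : \sum_i p i * (u i (X i) - u i z + (w z - w y)) <= A.
    rewrite -[leRHS]mul1r -p_sum1 mulr_suml.
    by apply: ler_sum => i _; rewrite ler_wpM2l// ltW.
  under eq_bigr do rewrite mulrDr mulrBr.
  rewrite big_split /= sumrB -mulr_suml p_sum1; lra.
exists X, y; split=> //.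
  by rewrite (le_trans _ bsq)// ler_wpM2l// ltW.
pose Q := \sum_i p i *: P i - (2 * b) *: (y - z).
have sPK : `|\sum_i p i *: P i| <= K.
  rewrite (le_trans (ler_norm_sum _ _ _))// -[leRHS]mul1r -p_sum1 mulr_suml.
  by apply: ler_sum => i _; rewrite normrZ gtr0_norm// ler_wpM2l// ltW.
(* The square of the left-hand side is [4 * b * (b * |y - z| ^+ 2)], at most [4 * (b * A)]. *)
have bt : `|(2 * b) *: (y - z)| <= t.
  rewrite -ler_sqr ?nnegrE ?(ltW t0)// normrZ gtr0_norm ?mulr_gt0//.
  rewrite !exprMn; apply: le_trans bA.
  have : b * (b * `|y - z| ^+ 2) <= b * A.
    by rewrite ler_pM2l// (le_trans _ bsq)// ler_pM2l.
  nra.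
have HQ : H Q y <= H (\sum_i p i *: P i) y + L * t.
  have := @H_lip Q (\sum_i p i *: P i) y y.
  rewrite subrr normr0 addr0 ler01 => h.
  have QE : `|Q - \sum_i p i *: P i| <= t.
    by rewrite /Q addrAC subrr add0r normrN.
  have : H Q y - H (\sum_i p i *: P i) y <= L * `|Q - \sum_i p i *: P i|.
    apply: h => //; last by lra.
    by rewrite /Q (le_trans (ler_normB _ _))//; lra.
  have := ler_wpM2l L_ge0 QE; lra.
have HX : \sum_i p i * H (P i) y <= \sum_i p i * (f i (X i) - a * u i (X i)) + L * t.
  have -> : L * t = \sum_i p i * (L * t) by rewrite -mulr_suml p_sum1 mul1r.
  rewrite -big_split /=; apply: ler_sum => i _.
  rewrite -mulrDr ler_wpM2l ?(ltW (p_gt0 i))//.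
  have h1 : H (P i) y - H (P i) (X i) <= L * t.
    have yX : `|y - X i| <= t by rewrite distrC.
    have := @H_lip (P i) (P i) y (X i); rewrite subrr normr0 add0r => h.
    have : H (P i) y - H (P i) (X i) <= L * `|y - X i|.
      by apply: h; rewrite ?(le_trans yX)// (le_trans (PK i))// lerDl.
    have := ler_wpM2l L_ge0 yX; lra.
  have := subX i; rewrite -/(P i); lra.
have := H_jensen P y.
move: supy HX; rewrite -/Q.
have -> : \sum_i p i * (f i (X i) - a * u i (X i)) =
    \sum_i p i * f i (X i) - a * \sum_i p i * u i (X i).
  by rewrite mulr_sumr -sumrB; apply: eq_bigr => i _; ring.
lra.
Qed.

End Comparison.

(** * Bounds for the discounted problems *)

Section DiscountedBounds.
Context {R : realType} {d : nat}.
Local Notation E := 'rV[R]_d.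
Variables (H : E -> E -> R) (Hbar K L B Zmax : R) (chi : E -> R).
Hypothesis H_jensen : forall (I : finType) (p : I -> R) (P : I -> E) x,
  (forall i, 0 <= p i) -> \sum_i p i = 1 ->
  H (\sum_i p i *: P i) x <= \sum_i p i * H (P i) x.
Hypotheses (K_ge0 : 0 <= K) (L_ge0 : 0 <= L).
Hypothesis H_lip : forall P Q x y, `|P| <= K + 1 -> `|Q| <= K + 1 ->
  `|x - y| <= 1 -> H P x - H Q y <= L * (`|P - Q| + `|x - y|).
Hypothesis H_coercive :
  forall P x, H P x <= `|Hbar| + 2 * B + Zmax -> `|P| <= K.
Hypotheses (chi_bound : forall x, `|chi x| <= B) (Zmax_ge0 : 0 <= Zmax).
Hypothesis chi_sol : viscosity_solution (fun _ p x => H p x - Hbar) chi.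

Let B_ge0 : 0 <= B. Proof. exact: le_trans (chi_bound 0). Qed.

Let chi_osc x y : chi x - chi y <= 2 * B.
Proof.
have := chi_bound x; have := chi_bound y; rewrite !ler_norml.
by move=> /andP[? ?] /andP[? ?]; lra.
Qed.

Let chi_cont : continuous chi. Proof. by case: chi_sol. Qed.

(** Discount rate 0 puts the corrector equation in the form that [comparison] expects. *)
Let chi_sub :
  viscosity_subsolution (fun r p x => 0 * r + (H p x - Hbar)) chi.
Proof.
case: chi_sol => _ sub _ phi x0 h1 h2; rewrite mul0r add0r.
exact: sub h1 h2.
Qed.

Let chi_super :
  viscosity_supersolution (fun r p x => 0 * r + (H p x - Hbar)) chi.
Proof.
case: chi_sol => _ _ sup phi x0 h1 h2; rewrite mul0r add0r.
exact: sup h1 h2.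
Qed.

Let bounded_osc (v : E -> R) : bounded_fun v ->
  exists2 V, 0 <= V & forall x y, v x - v y <= V.
Proof.
move=> [M [_ Mv]]; have {}Mv x : `|v x| <= `|M| + 1.
  by apply: Mv => //; rewrite (le_lt_trans (ler_norm _))// ltrDl.
exists (2 * (`|M| + 1)); first by rewrite mulr_ge0// addr_ge0.
move=> x y; have := Mv x; have := Mv y; rewrite !ler_norml.
by move=> /andP[? ?] /andP[? ?]; lra.
Qed.

(** The parameters [t] and [b], hence the radius [n], depend on [A] and [e] but not on the family of
    subsolutions or its size. This lets the box of Bernoulli variables be fixed before the samples
    are drawn. *)
Lemma comparison_error (A e : R) : 0 <= A -> 0 < e -> exists n : nat,
  forall (I : finType) (p : I -> R) (u f : I -> E -> R) (a : R)
    (w : E -> R) (g c : R) (z : E),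
  (forall i, 0 < p i) -> \sum_i p i = 1 ->
  (forall i, continuous (u i)) -> continuous w ->
  (forall i, viscosity_subsolution (fun r P x => a * r + (H P x - f i x)) (u i)) ->
  (forall i P x, a * u i x + (H P x - f i x) <= 0 -> `|P| <= K) ->
  viscosity_supersolution (fun r P x => c * r + (H P x - g)) w ->
  (forall i x y, u i x - u i z + (w z - w y) <= A) ->
  exists (X : I -> E) (y : E), [/\ forall i, `|X i - y| <= 1,
    `|y - z| <= n%:R,
    \sum_i p i * u i z - w z <= \sum_i p i * u i (X i) - w y &
    a * \sum_i p i * u i (X i) - c * w y <= \sum_i p i * f i (X i) - g + e].
Proof.
move=> A0 e0.
pose t := Num.min 1 (e / (2 * L + 1)).
have L1 : 0 < 2 * L + 1 by rewrite ltr_wpDl// mulr_ge0.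
have t0 : 0 < t by rewrite lt_min ltr01 divr_gt0.
have t1 : 0 < t <= 1 by rewrite t0 ge_min lexx.
have te : 2 * L * t <= e.
  have : t <= e / (2 * L + 1) by rewrite ge_min lexx orbT.
  by rewrite ler_pdivlMr//; lra.
(* Then [4 * (b * A) = t ^+ 2 * (A / (A + 1))], as [comparison] requires. *)
pose b := t ^+ 2 / (4 * (A + 1)).
have A1 : 0 < A + 1 by rewrite ltr_wpDl.
have b0 : 0 < b by rewrite divr_gt0 ?exprn_gt0// mulr_gt0.
have bA : 4 * (b * A) <= t ^+ 2.
  have -> : 4 * (b * A) = t ^+ 2 * (A / (A + 1)).
    by rewrite /b; field; rewrite gt_eqF.
  by rewrite ler_piMr ?sqr_ge0// ler_pdivrMr// mul1r lerDl.
exists (Num.truncn (1 + A / b)).+1 => I p u f a w g c z.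
move=> p0 p1 cu cw subu coer supw osc.
have p0' i : 0 <= p i by exact: ltW.
have jen (P : I -> E) x := @H_jensen I p P x p0' p1.
have [X [y [Xy yz h1 h2]]] :=
  comparison p0 p1 jen K_ge0 L_ge0 H_lip cu cw subu coer supw t1 b0 bA osc.
exists X, y; split=> //.
- by move=> i; rewrite (le_trans (Xy i))//; case/andP: t1.
- apply: (@le_trans _ _ (1 + A / b)); last first.
    by rewrite ltW// truncnS_gt.
  have : `|y - z| ^+ 2 <= A / b by rewrite ler_pdivlMr// mulrC.
  have := sqr_ge0 (`|y - z| - 1); rewrite sqrrB1.
  have := normr_ge0 (y - z); rewrite -mulr_natl; lra.
- by apply: le_trans h2 _; rewrite lerD2l.
Qed.

(** Since [f >= 0], [v] is a supersolution of the problem without [f]; it is compared with [chi] as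
    a one-element family of subsolutions. The oscillation of [chi] costs [delta * (2 * B)]. *)
Lemma discounted_lower (f v : E -> R) (delta : R) : (forall x, 0 <= f x) ->
  0 < delta -> bounded_discounted_solution (fun p x => H p x - f x) delta v ->
  forall z, - (delta * v z) <= Hbar + delta * (2 * B).
Proof.
move=> f0 delta0 [/bounded_osc[V V0 vosc] [cv _ supv]] z.
apply/ler_addgt0Pr => e e0.
have A0 : 0 <= 2 * B + V by rewrite addr_ge0// mulr_ge0.
have [n Hn] := comparison_error A0 e0.
have coer (i : 'I_1) P x : 0 * chi x + (H P x - Hbar) <= 0 -> `|P| <= K.
  rewrite mul0r add0r => h; apply: (@H_coercive P x).
  by have := Zmax_ge0; have := ler_norm Hbar; have := B_ge0; lra.
have sup : viscosity_supersolution (fun r P x => delta * r + (H P x - 0)) v.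
  by move=> phi x0 h1 h2; have := supv _ _ h1 h2; have := f0 x0; lra.
have osc (i : 'I_1) x y : chi x - chi z + (v z - v y) <= 2 * B + V.
  by have := chi_osc x z; have := vosc z y; lra.
have [X [y [_ _]]] := Hn 'I_1 (fun=> 1) (fun=> chi) (fun _ _ => Hbar) 0 v 0 delta
  z (fun=> ltr01) (big_ord1 _ _) (fun=> chi_cont) cv (fun=> chi_sub) coer sup osc.
rewrite !big_ord1 !mul1r mul0r.
have := chi_osc (X ord0) z; set q := X ord0 => h0 h1 h2.
have : delta * (v y - v z) <= delta * (2 * B) by rewrite ler_pM2l//; lra.
lra.
Qed.

(** The roles are exchanged: [v] is the subsolution and [chi] the supersolution, and [f] costs at
    most [Zmax]. *)
Lemma discounted_upper (f v : E -> R) (delta : R) :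
  (forall x, 0 <= f x <= Zmax) -> 0 < delta <= 1 ->
  bounded_discounted_solution (fun p x => H p x - f x) delta v ->
  forall z, delta * v z <= - Hbar + delta * (2 * B) + Zmax.
Proof.
move=> f0 /andP[delta0 delta1] sol z.
have f00 x : 0 <= f x by case/andP: (f0 x).
have low := discounted_lower f00 delta0 sol.
case: sol => [/bounded_osc[V V0 vosc] [cv subv _]].
apply/ler_addgt0Pr => e e0.
have A0 : 0 <= V + 2 * B by rewrite addr_ge0// mulr_ge0.
have [n Hn] := comparison_error A0 e0.
(* The subsolution inequality and [discounted_lower] give [H P x <= Hbar + delta * (2 * B) + Zmax],
   which is below the coercivity threshold as [delta <= 1]. *)
have coer (i : 'I_1) P x : delta * v x + (H P x - f x) <= 0 -> `|P| <= K.
  move=> h; apply: (@H_coercive P x).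
  have := low x; have := Zmax_ge0; have := ler_norm Hbar; have /andP[_] := f0 x.
  have : delta * (2 * B) <= 2 * B by rewrite ler_piMl// mulr_ge0.
  lra.
have osc (i : 'I_1) x y : v x - v z + (chi z - chi y) <= V + 2 * B.
  by have := chi_osc z y; have := vosc x z; lra.
have [X [y [_ _]]] := Hn 'I_1 (fun=> 1) (fun=> v) (fun=> f) delta chi Hbar 0
  z (fun=> ltr01) (big_ord1 _ _) (fun=> cv) chi_cont (fun=> subv) coer chi_super osc.
rewrite !big_ord1 !mul1r mul0r.
have := chi_osc z y; set q := X ord0 => h0 h1 h2.
have : delta * (v z - v q) <= delta * (2 * B) by rewrite ler_pM2l//; lra.
have /andP[_] := f0 q.
lra.
Qed.

Lemma discounted_average (delta e : R) : 0 < delta <= 1 -> 0 < e ->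
  exists n : nat, forall (I : finType) (p : I -> R) (f v : I -> E -> R),
  (forall i, 0 < p i) -> \sum_i p i = 1 ->
  (forall i x, 0 <= f i x <= Zmax) ->
  (forall i, bounded_discounted_solution
    (fun p x => H p x - f i x) delta (v i)) ->
  exists (X : I -> E) (y : E), [/\ forall i, `|X i - y| <= 1, `|y| <= n%:R &
    delta * \sum_i p i * v i 0 <=
    - Hbar + delta * (2 * B) + \sum_i p i * f i (X i) + e].
Proof.
move=> /andP[delta0 delta1] e0.
(* The two bounds on [delta * v] limit the increments of every sample by [(4 * B + Zmax) / delta],
   uniformly over families; [2 * B] accounts for [chi]. *)
have A0 : 0 <= (4 * B + Zmax) / delta + 2 * B.
  by rewrite addr_ge0 ?divr_ge0 ?addr_ge0 ?mulr_ge0 // ltW.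
have [n Hn] := comparison_error A0 e0.
exists n => I p f v p0 p1 f0 sol.
have f00 i x : 0 <= f i x by case/andP: (f0 i x).
have d01 : 0 < delta <= 1 by rewrite delta0.
have low i := discounted_lower (f00 i) delta0 (sol i).
have upp i := discounted_upper (f0 i) d01 (sol i).
have dB : delta * (2 * B) <= 2 * B by rewrite ler_piMl// mulr_ge0.
have coer i P x : delta * v i x + (H P x - f i x) <= 0 -> `|P| <= K.
  move=> h; apply: (@H_coercive P x).
  have := low i x; have := Zmax_ge0; have := ler_norm Hbar; have /andP[_] := f0 i x.
  lra.
have osc i x y : v i x - v i 0 + (chi 0 - chi y) <=
    (4 * B + Zmax) / delta + 2 * B.
  rewrite lerD// ler_pdivlMr//.
  by have := low i 0; have := upp i x; lra.
have cv i : continuous (v i) by have [_ []] := sol i.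
have subv i : viscosity_subsolution
    (fun r P x => delta * r + (H P x - f i x)) (v i) by have [_ []] := sol i.
have [X [y [Xy]]] := Hn I p v f delta chi Hbar 0 0 p0 p1
  cv chi_cont subv coer chi_super osc.
rewrite subr0 => yn h1 h2; exists X, y; split=> //.
have := chi_osc 0 y => h0.
set S0 := \sum_i p i * v i 0 in h1 *.
set S := \sum_i p i * v i (X i) in h1 h2.
have : delta * (S0 - S) <= delta * (2 * B) by rewrite ler_pM2l//; lra.
lra.
Qed.

End DiscountedBounds.

(** * Lattice sums and finite configurations *)

Section LatticeSums.
Context {R : realType} {d : nat}.
Local Notation E := 'rV[R]_d.
Local Notation Zd := 'rV[int]_d.

(** The candidates fill a box of side [2 * r + 1] around the integer part of [y], so their number is
    bounded independently of [y]. *)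
Definition lattice_near (r : nat) (y : E) : seq Zd :=
  [seq k <- undup [seq \row_j (Num.floor (y 0 j) + (m j : nat)%:Z - r%:Z)
     | m : {ffun 'I_d -> 'I_(2 * r).+1}] | `|y - map_mx intr k| <= r%:R].

Lemma mem_lattice_near r y k :
  (k \in lattice_near r y) = (`|y - map_mx intr k| <= r%:R).
Proof.
rewrite mem_filter andb_idr// => yk; rewrite mem_undup.
have kr j : 0 <= k 0 j - Num.floor (y 0 j) + r%:Z < (2 * r).+1%:Z.
  have := le_trans (coord_le_norm _ j) yk; rewrite !mxE ler_norml.
  have := floor_itv (y 0 j); rewrite intrD mulr1z => /andP[h1 h2] /andP[h3 h4].
  have h5 : - (r%:Z%:~R : R) - 1 < (k 0 j - Num.floor (y 0 j))%:~R.
    by rewrite intrB -pmulrn; lra.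
  have h6 : ((k 0 j - Num.floor (y 0 j))%:~R : R) < r%:Z%:~R + 1.
    by rewrite intrB -pmulrn; lra.
  rewrite -[1]/(1%:~R) -intrN -intrB ltr_int in h5.
  rewrite -[1]/(1%:~R) -intrD ltr_int in h6.
  lia.
apply/mapP; exists [ffun j => inord (absz (k 0 j - Num.floor (y 0 j) + r%:Z)%R)].
  by rewrite mem_enum.
apply/rowP => j; rewrite !mxE ffunE inordK; have := kr j; lia.
Qed.

Lemma size_lattice_near r y : (size (lattice_near r y) <= (2 * r).+1 ^ d)%N.
Proof.
rewrite size_filter (leq_trans (count_size _ _))//.
rewrite (leq_trans (size_undup _))// size_map -cardE card_ffun !card_ord.
by rewrite leqnn.
Qed.

Lemma lattice_near_uniq r y : uniq (lattice_near r y).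
Proof. by rewrite filter_uniq// undup_uniq. Qed.

(** Enlarging the support radius by one gives a single finite index set for all [x] within distance
    1 of [y]. *)
Lemma lattice_sumE (zeta : E -> R) (c : Zd -> R) (r : nat) x y :
  (forall x, zeta x != 0 -> `|x| <= r%:R) -> `|x - y| <= 1 ->
  \sum_(k \in [set: Zd]) (c k * zeta (x - map_mx intr k)) =
  \sum_(k <- lattice_near r.+1 y) c k * zeta (x - map_mx intr k).
Proof.
move=> supp xy; rewrite [RHS](@bigfs _ _ _ _ _ xpredT) ?lattice_near_uniq//.
  by apply: eq_fsbigl; apply/seteqP.
move=> k _; rewrite mem_lattice_near => yk; apply/eqP.
apply: contraNT yk; rewrite mulf_eq0 negb_or => /andP[_ /supp xk].
have -> : y - map_mx intr k = (x - map_mx intr k) - (x - y).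
  by apply/rowP => j; rewrite !mxE; ring.
by rewrite (le_trans (ler_normB _ _))// -natr1 lerD.
Qed.

Lemma lattice_sum_le (zeta : E -> R) (c : Zd -> R) (r : nat) (Z : R) x y :
  (forall x, zeta x != 0 -> `|x| <= r%:R) -> (forall x, zeta x <= Z) ->
  (forall k, 0 <= c k) -> `|x - y| <= 1 ->
  \sum_(k \in [set: Zd]) (c k * zeta (x - map_mx intr k)) <=
  Z * \sum_(k <- lattice_near r.+1 y) c k.
Proof.
move=> supp zZ c0 xy; rewrite (lattice_sumE _ supp xy) mulr_sumr.
by apply: ler_sum => k _; rewrite mulrC ler_wpM2r.
Qed.

End LatticeSums.

(** * Product Bernoulli weights and the cylinders that carry them *)

Section CylinderWeights.
Context {R : realFieldType} {T : finType}.
Variable eta : R.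
Hypothesis eta01 : 0 < eta < 1.

Definition cyl_weight (s : {ffun T -> bool}) : R :=
  \prod_t (if s t then eta else 1 - eta).

Lemma cyl_weight_gt0 s : 0 < cyl_weight s.
Proof. by apply: prodr_gt0 => t _; case: ifP => _; move: eta01; lra. Qed.

Lemma sum_cyl_weight : \sum_s cyl_weight s = 1.
Proof.
rewrite -(bigA_distr_bigA (fun (_ : T) (c : bool) => if c then eta else 1 - eta)).
by rewrite big1// => t _; rewrite big_bool /= addrC subrK.
Qed.

(** The factor at [t0] absorbs the coordinate; distributivity then gives a product of two-term sums,
    equal to [eta] at [t0] and to 1 elsewhere. *)
Lemma sum_cyl_weight_coord t0 : \sum_s cyl_weight s * (s t0)%:R = eta.
Proof.
pose h (t : T) (c : bool) := (if c then eta else 1 - eta) *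
  (if t == t0 then c%:R else 1).
transitivity (\sum_(s : {ffun T -> bool}) \prod_t h t (s t)).
  apply: eq_bigr => s _; rewrite big_split /=; congr (_ * _).
  by rewrite (bigD1 t0)//= eqxx big1 ?mulr1// => t /negbTE ->.
rewrite -(bigA_distr_bigA h) (bigD1 t0)//= [X in _ * X]big1.
  by rewrite big_bool /h eqxx /= mulr0 !mulr1 addr0.
by move=> t /negbTE tt0; rewrite big_bool /h tt0 /= !mulr1 addrC subrK.
Qed.

End CylinderWeights.

Section Cylinders.
Context {R : realType} {disp : measure_display} {Omega : measurableType disp}.
Variables (P : probability Omega R) (I : choiceType) (X : I -> {RV P >-> R}).
Variables (eta : R) (J : {fset I}).
Hypothesis X_indep : mutually_independent X.
Hypothesis X1 : forall k, P (X k @^-1` [set 1]) = eta%:E.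
Hypothesis X0 : forall k, P (X k @^-1` [set 0]) = (1 - eta)%:E.
Implicit Types s : {ffun J -> bool}.

(** [mutually_independent] takes events indexed by all of [I], so [s] is extended by [false] outside
    [J]. *)
Let level s (k : I) : set R :=
  [set (if insub k is Some t then s t else false)%:R].

Definition cylinder s : set Omega := \bigcap_(k in [set` J]) (X k @^-1` level s k).

Lemma cylinder_val s w (t : J) : cylinder s w -> X (val t) w = (s t)%:R.
Proof.
by move=> /(_ (val t) (valP t)); rewrite /level /= valK.
Qed.

Lemma measurable_cylinder s : measurable (cylinder s).
Proof.
apply: fin_bigcap_measurable => // k _; rewrite -[X in measurable X]setTI.
by apply: measurable_funP => //; exact: measurable_set1.
Qed.

Lemma probability_cylinder s : P (cylinder s) = (cyl_weight eta s)%:E.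
Proof.
rewrite /cylinder X_indep; last by move=> i; exact: measurable_set1.
rewrite big_seq_fsetE /= /cyl_weight -prodEFin; apply: eq_bigr => t _.
by rewrite /level valK; case: (s t); [exact: X1|exact: X0].
Qed.

Lemma trivIset_cylinder (D : set {ffun J -> bool}) : trivIset D cylinder.
Proof.
move=> s s' _ _ [w [ws ws']]; apply/ffunP => t.
have := cylinder_val t ws; rewrite (cylinder_val t ws').
by case: (s t); case: (s' t) => //= /eqP; rewrite ?oner_eq0 // eq_sym oner_eq0.
Qed.

Lemma probability_cylinders (Q : pred {ffun J -> bool}) :
  P (\bigcup_(s in [set` Q]) cylinder s) = (\sum_(s | Q s) cyl_weight eta s)%:E.
Proof.
rewrite measure_fin_bigcup //; last by move=> s _; exact: measurable_cylinder.
  rewrite -(@bigfs _ _ _ _ (index_enum _) Q).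
  - rewrite -sumEFin; apply: eq_bigr => s _; exact: probability_cylinder.
  - exact: index_enum_uniq.
  - by move=> s _; rewrite mem_index_enum.
exact: trivIset_cylinder.
Qed.

Lemma measurable_cylinders (Q : pred {ffun J -> bool}) :
  measurable (\bigcup_(s in [set` Q]) cylinder s).
Proof.
apply: fin_bigcup_measurable => // s _; exact: measurable_cylinder.
Qed.

End Cylinders.

(** * Deviation estimate at a fixed discount [delta] *)

Section OneScale.
Context {R : realType} {d : nat}.
Local Notation E := 'rV[R]_d.
Local Notation Zd := 'rV[int]_d.
Variables (zeta : E -> R) (r : nat) (Z : R).
Hypotheses (zeta_ge0 : forall x, 0 <= zeta x) (zeta_le : forall x, zeta x <= Z).
Hypothesis zeta_supp : forall x, zeta x != 0 -> `|x| <= r%:R.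
Let N0 : R := ((2 * r.+1).+1 ^ d)%:R.
Variables (H : E -> E -> R) (Hbar K L B : R) (chi : E -> R).
Hypothesis H_jensen : forall (I : finType) (p : I -> R) (P : I -> E) x,
  (forall i, 0 <= p i) -> \sum_i p i = 1 ->
  H (\sum_i p i *: P i) x <= \sum_i p i * H (P i) x.
Hypotheses (K_ge0 : 0 <= K) (L_ge0 : 0 <= L).
Hypothesis H_lip : forall P Q x y, `|P| <= K + 1 -> `|Q| <= K + 1 ->
  `|x - y| <= 1 -> H P x - H Q y <= L * (`|P - Q| + `|x - y|).
Hypothesis H_coercive :
  forall P x, H P x <= `|Hbar| + 2 * B + Z * N0 -> `|P| <= K.
Hypothesis chi_bound : forall x, `|chi x| <= B.
Hypothesis chi_sol : viscosity_solution (fun _ p x => H p x - Hbar) chi.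
Context {disp : measure_display} {Omega : measurableType disp}.
Variables (P : probability Omega R) (X : Zd -> {RV P >-> R}) (eta : R).
Hypotheses (eta01 : 0 < eta < 1) (X_indep : mutually_independent X).
Hypothesis X1 : forall k, P (X k @^-1` [set 1]) = eta%:E.
Hypothesis X0 : forall k, P (X k @^-1` [set 0]) = (1 - eta)%:E.
(** [G] stands for an almost sure set that may fail to be measurable; meeting every event of
    positive probability is enough to draw samples from it. *)
Variables (G : set Omega).
Hypothesis G_meets : forall U, measurable U -> (0 < P U)%E -> U `&` G !=set0.
Hypothesis X01 : forall w, G w -> forall k, 0 <= X k w <= 1.

Let Z_ge0 : 0 <= Z. Proof. exact: le_trans (zeta_ge0 0) (zeta_le 0). Qed.

Lemma bump_sum_le w x y : G w -> `|x - y| <= 1 ->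
  bump_sum zeta X w x <= Z * \sum_(k <- lattice_near r.+1 y) X k w.
Proof.
move=> Gw xy; apply: (lattice_sum_le zeta_supp zeta_le) => // k.
by case/andP: (X01 Gw k).
Qed.

Lemma bump_sum_bound w x : G w -> 0 <= bump_sum zeta X w x <= Z * N0.
Proof.
move=> Gw; apply/andP; split.
  by apply: fsumr_ge0 => k _; rewrite mulr_ge0//; case/andP: (X01 Gw k).
have xx : `|x - x| <= 1 by rewrite subrr normr0.
apply: le_trans (bump_sum_le Gw xx) _; rewrite ler_wpM2l//.
apply: (@le_trans _ _ (\sum_(k <- lattice_near r.+1 x) 1)).
  by apply: ler_sum => k _; case/andP: (X01 Gw k).
by rewrite big_const_seq count_predT iter_addr_0 /N0 ler_nat size_lattice_near.
Qed.

(* The configuration in a large finite box is averaged exactly; only what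
   happens inside the box matters, since the points found by
   [discounted_average] stay in a ball that does not depend on it. *)
Lemma deviation (v : Omega -> E -> R) (delta e s : R) :
  0 < delta <= 1 -> 0 < e -> s <= Hbar + 2 * B ->
  (forall w, G w -> bounded_discounted_solution
    (fun p x => H p x - bump_sum zeta X w x) delta (v w)) ->
  exists U (q : R), [/\ measurable U, P U = q%:E,
    U `&` G `<=` [set w | s < - (delta * v w 0)] &
    Hbar - delta * (2 * B) - Z * N0 * eta - e <= s + (Hbar + 2 * B - s) * q].
Proof.
move=> d01 e0 sM sol; set Bad := mkset _.
have Zmax0 : 0 <= Z * N0 by rewrite mulr_ge0.
have [delta0 delta1] := andP d01.
have [n Hn] := discounted_average H_jensen K_ge0 L_ge0 H_lip H_coercive
  chi_bound Zmax0 chi_sol d01 e0.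
(* The points have [|y| <= n], and the bumps felt within distance 1 of [y] sit within [r.+1] of
   it. *)
pose J := [fset k in lattice_near (R := R) (n + r.+1) (0 : E)]%fset.
(* Selecting whole cylinders makes their union measurable even if [Bad] is not. *)
pose Q (c : {ffun J -> bool}) := `[< cylinder X c `&` G `<=` Bad >].
exists (\bigcup_(c in [set` Q]) cylinder X c),
  (\sum_(c | Q c) cyl_weight eta c); split.
- exact: measurable_cylinders.
- exact: probability_cylinders.
- by move=> w [[c /asboolP Qc cw] Gw]; exact: Qc.
have cylG (c : {ffun J -> bool}) : cylinder X c `&` G !=set0.
  apply: G_meets; first exact: measurable_cylinder.
  by rewrite (probability_cylinder X_indep X1 X0) lte_fin cyl_weight_gt0.
(* One sample in [G] per cylinder; when the cylinder is not selected, the sample is taken outside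
   [Bad]. *)
have /choice[W HW] (c : {ffun J -> bool}) :
    exists w, [/\ cylinder X c w, G w & ~~ Q c -> ~ Bad w].
  have [/asboolP Qc|/asboolPn] := boolP (Q c).
    by have [w [cw Gw]] := cylG c; exists w.
  move=> /existsNP[w /not_implyP[[cw Gw] Bw]]; by exists w.
have GW c : G (W c) by case: (HW c).
have Wval c t : X (val t) (W c) = (c t)%:R.
  by apply: cylinder_val; case: (HW c).
have [Y [y [Yy yn main]]] := Hn {ffun J -> bool} (cyl_weight eta)
  (fun c => bump_sum zeta X (W c)) (fun c => v (W c))
  (cyl_weight_gt0 eta01) (sum_cyl_weight eta)
  (fun c x => bump_sum_bound x (GW c)) (fun c => sol _ (GW c)).
have nearJ k : k \in lattice_near r.+1 y -> k \in J.
  rewrite !inE !mem_lattice_near sub0r => yk.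
  have -> : - map_mx intr k = (y - map_mx intr k) - y :> E.
    by rewrite addrAC subrr add0r.
  by rewrite (le_trans (ler_normB _ _))// addrC natrD lerD.
(* On the samples [X k] is a coordinate of [c], of mean [eta], and at most [N0] lattice points
   contribute. *)
have avg : \sum_c cyl_weight eta c * bump_sum zeta X (W c) (Y c) <= Z * N0 * eta.
  have h c : cyl_weight eta c * bump_sum zeta X (W c) (Y c) <=
      Z * \sum_(k <- lattice_near r.+1 y) cyl_weight eta c * X k (W c).
    rewrite -mulr_sumr mulrCA ler_wpM2l ?(ltW (cyl_weight_gt0 eta01 c))//.
    exact: bump_sum_le.
  apply: le_trans (ler_sum _ (fun c _ => h c)) _.
  rewrite -mulr_sumr exchange_big /= -mulrA ler_wpM2l//.
  rewrite (eq_big_seq (fun=> eta)); last first.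
    move=> k /nearJ kJ; rewrite -[RHS](sum_cyl_weight_coord eta [` kJ]%fset).
    by apply: eq_bigr => c _; rewrite -Wval.
  rewrite big_const_seq count_predT iter_addr_0 -mulr_natl ler_wpM2r//.
    by move: eta01; lra.
  by rewrite ler_nat size_lattice_near.
have low c z := discounted_lower H_jensen K_ge0 L_ge0 H_lip H_coercive chi_bound
  Zmax0 chi_sol (fun x => proj1 (andP (bump_sum_bound x (GW c)))) delta0
  (sol _ (GW c)) z.
(* Samples of unselected cylinders contribute at most [s], the others at most [Hbar + 2 * B] by
   [discounted_lower]. *)
have up : \sum_c cyl_weight eta c * - (delta * v (W c) 0) <=
    s + (Hbar + 2 * B - s) * \sum_(c | Q c) cyl_weight eta c.
  have B0 : 0 <= B by exact: le_trans (chi_bound 0).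
  have dB : delta * (2 * B) <= 2 * B by rewrite ler_piMl// mulr_ge0.
  have {1}-> : s = \sum_(c : {ffun J -> bool}) cyl_weight eta c * s.
    by rewrite -mulr_suml sum_cyl_weight mul1r.
  rewrite (big_mkcond Q) mulr_sumr -big_split /=; apply: ler_sum => c _.
  have pc := cyl_weight_gt0 eta01 c.
  case: ifPn => Qc; last first.
    rewrite mulr0 addr0 ler_pM2l//.
    have [_ _ /(_ Qc)] := HW c; rewrite /Bad /= => /negP; rewrite -leNgt.
    exact.
  rewrite [X in _ + X]mulrC -mulrDr ler_pM2l//.
  by have := low c 0; lra.
apply: le_trans up.
rewrite (_ : \sum_c _ = - (delta * \sum_c cyl_weight eta c * v (W c) 0)).
  by move: main avg; lra.
by rewrite mulr_sumr -sumrN; apply: eq_bigr => c _; ring.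
Qed.

End OneScale.

(** * Passage to the limit *)

Lemma compactly_supported_radius (R : realType) d (f : 'rV[R]_d -> R) :
  compactly_supported f -> exists r : nat, forall x, f x != 0 -> `|x| <= r%:R.
Proof.
move=> /compact_bounded[M [_ fM]]; exists (Num.truncn (M + 1)).+1 => x fx.
apply: (@le_trans _ _ (M + 1)); last by rewrite ltW// truncnS_gt.
by apply: fM; [rewrite ltrDl|exact: subset_closure].
Qed.

Lemma lipschitz_compact_le (R : realType) d (f : 'rV[R]_d -> R) (r : nat) :
  lipschitz f -> (forall x, f x != 0 -> `|x| <= r%:R) ->
  exists Z, forall x, f x <= Z.
Proof.
move=> [k [_ fk]] supp; exists (`|f 0| + (`|k| + 1) * r%:R) => x.
have k1 : k < `|k| + 1 by rewrite (le_lt_trans (ler_norm _))// ltrDl.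
have [->|/supp xr] := eqVneq (f x) 0.
  by rewrite addr_ge0// mulr_ge0// addr_ge0.
have := fk _ k1 (x, 0) (conj I I) => /=; rewrite subr0 => h.
have : (`|k| + 1) * `|x| <= (`|k| + 1) * r%:R by rewrite ler_wpM2l// addr_ge0.
have := ler_norm (f x - f 0); have := ler_norm (f 0); lra.
Qed.

Section Probability.
Context {R : realType} {disp : measure_display} {Omega : measurableType disp}.
Variable P : probability Omega R.

(** Otherwise [U] would lie in a null set containing the complement of [G]. *)
Lemma ae_meets (G U : set Omega) : (\forall w \ae P, G w) ->
  measurable U -> (0 < P U)%E -> U `&` G !=set0.
Proof.
move=> [N [mN PN GN]] mU PU; apply/set0P/negP => /eqP UG.
move: PU; rewrite ltNge => /negP; apply; rewrite -PN le_measure ?inE//.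
by move=> w Uw; apply: GN => Gw; suff : set0 w by []; rewrite -UG.
Qed.

(** The tail unions have probability at least [q] and decrease to the limsup, which thus has
    positive probability and meets [G]. *)
Lemma limsup_meets (G : set Omega) (U : nat -> set Omega) (q : R) :
  (\forall w \ae P, G w) -> (forall n, measurable (U n)) -> 0 < q ->
  (forall n, q%:E <= P (U n))%E ->
  exists2 w, G w & forall m, exists2 n, (m <= n)%N & U n w.
Proof.
move=> aeG mU q0 qU.
have mB n : measurable (\bigcup_(k >= n) U k) by exact: bigcup_measurable.
have cvgU := lim_sup_set_cvg P U mU (le_lt_trans (probability_le1 P (mB 0)) (ltry _)).
have qS : (q%:E <= P (lim_sup_set U))%E.
  apply: cvge_to_ge cvgU _; apply: nearW => n.
  apply: le_trans (qU n) _; apply: le_measure; rewrite ?inE//.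
  by apply: bigcup_sup => /=.
have [||w [Uw Gw]] := ae_meets aeG (U := lim_sup_set U).
- by apply: bigcap_measurable => // n _; exact: mB.
- by rewrite (lt_le_trans _ qS)// lte_fin.
by exists w => // m; have [n /= mn Un] := Uw m I; exists n.
Qed.

Lemma ae_zero_one (X : {RV P >-> R}) (eta : R) :
  P (X @^-1` [set 1]) = eta%:E -> P (X @^-1` [set 0]) = (1 - eta)%:E ->
  \forall w \ae P, 0 <= X w <= 1.
Proof.
move=> X1 X0.
have m (x : R) : measurable (X @^-1` [set x]).
  by rewrite -[_ @^-1` _]setTI; exact: measurable_funP.
exists (~` (X @^-1` [set 1] `|` X @^-1` [set 0])); split.
- by apply: measurableC; exact: measurableU.
- rewrite probability_setC; last exact: measurableU.
  suff -> : P (X @^-1` [set 1] `|` X @^-1` [set 0]) = 1%E by rewrite subee.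
  transitivity (P (X @^-1` [set 1%R]) + P (X @^-1` [set 0%R]))%E.
    apply: measureU => //; apply/seteqP; split=> // w [/= ->] /eqP.
    by rewrite oner_eq0.
  by rewrite X1 X0 -EFinD addrC subrK.
- move=> w /=; apply: contra_not => -[] /= ->.
    by rewrite ler01 lexx.
  by rewrite ler01 lexx.
Qed.

End Probability.

Lemma superlinear_coercive (R : realType) d (H : 'rV[R]_d -> 'rV[R]_d -> R) :
  (forall M : R, exists r : R, forall p x : 'rV[R]_d,
    r < `|p| -> M < `|p|^-1 * H p x) ->
  forall M, 0 <= M -> exists2 K, 0 <= K & forall p x, H p x <= M -> `|p| <= K.
Proof.
move=> sup M M0; have [r Hr] := sup M.
exists (`|r| + 1) => [|p x]; first exact: addr_ge0.
apply: contraTT; rewrite -!ltNge => rp.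
have p1 : 1 <= `|p| by apply: le_trans (ltW rp); rewrite lerDr.
have p0 : 0 < `|p| by rewrite (lt_le_trans _ p1).
have : M < `|p|^-1 * H p x.
  by apply: Hr; rewrite (le_lt_trans _ rp)// ler_wpDr// ler_norm.
by rewrite mulrC ltr_pdivlMr//; apply: le_lt_trans; rewrite ler_peMr.
Qed.

Theorem corollary3p4 (R : realType) (d : nat) (d_gt0 : (0 < d)%N)
    (zeta : 'rV[R]_d -> R)
    (zeta_ge0 : forall x, 0 <= zeta x)
    (zeta_lip : lipschitz zeta)
    (zeta_supp : compactly_supported zeta) :
  exists C : R, 0 < C /\
    forall H : 'rV[R]_d -> 'rV[R]_d -> R,
      C2 (fun z : 'rV[R]_d * 'rV[R]_d => H z.1 z.2) ->
      (forall p, Zd_periodic (H p)) ->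
      (forall p x, positive_definite (hessian (fun q => H q x) p)) ->
      (forall M : R, exists r : R, forall p x : 'rV[R]_d,
         r < `|p| -> M < `|p|^-1 * H p x) ->
    forall Hbar : R, effective_constant H Hbar ->
    forall eta : R, 0 < eta < 1 ->
    forall (disp : measure_display) (Omega : measurableType disp)
      (P : probability Omega R) (X : 'rV[int]_d -> {RV P >-> R}),
      iid_Bernoulli eta X ->
    forall Hbar_eta : R,
      random_effective_constant P
        (fun w p x => H p x - bump_sum zeta X w x) Hbar_eta ->
      0 <= Hbar - Hbar_eta <= C * eta.
Proof.
have [r supp] := compactly_supported_radius zeta_supp.
have [Z zetaZ] := lipschitz_compact_le zeta_lip supp.
have Z0 : 0 <= Z := le_trans (zeta_ge0 0) (zetaZ 0).
pose N0 : R := ((2 * r.+1).+1 ^ d)%:R.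
have ZN0 : 0 <= Z * N0 by rewrite mulr_ge0.
(* The sup of [zeta] times the number of overlapping bumps; the [+ 1] keeps the constant positive
   when [Z] is 0. *)
exists (Z * N0 + 1); split; first by rewrite ltr_wpDl.
move=> H cH pH posH supH Hbar [chi [chi_per chi_sol]] eta eta01.
move=> disp Omega P X [X_indep X_id X10 X00] c aec.
have chi_cont : continuous chi by case: chi_sol.
have [B chiB] := periodic_bounded chi_cont chi_per.
have B0 : 0 <= B by exact: le_trans (chiB 0).
have [|K K0 coer] := superlinear_coercive supH (M := `|Hbar| + 2 * B + Z * N0).
  by apply: addr_ge0 => //; rewrite addr_ge0// mulr_ge0.
have [L L0 lip] := periodic_lipschitz cH.1 pH (K + 1).
have jen (I : finType) (p : I -> R) (Q : I -> 'rV[R]_d) x :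
    (forall i, 0 <= p i) -> \sum_i p i = 1 ->
    H (\sum_i p i *: Q i) x <= \sum_i p i * H (Q i) x.
  have C2x : C2 (fun q => H q x) := C2_slice x cH.
  by move=> p0 p1; exact: (jensen C2x (fun q => posH q x) Q p0 p1).
have X1 k : P (X k @^-1` [set 1]) = eta%:E by rewrite X_id.
have X0 k : P (X k @^-1` [set 0]) = (1 - eta)%:E by rewrite X_id.
have aeX : \forall w \ae P, forall k, 0 <= X k w <= 1.
  (* The lattice is countable: the almost sure bound is intersected over codes [n]. *)
  have h : \forall w \ae P, forall n,
      if (choice.unpickle n : option 'rV[int]_d) is Some k then 0 <= X k w <= 1 else true.
    apply: ae_foralln => n; case: (choice.unpickle n : option 'rV[int]_d) => [k|].
      exact: ae_zero_one (X1 k) (X0 k).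
    exact: aeW.
  by apply: filterS h => w h k; have := h (choice.pickle k); rewrite choice.pickleK.
pose sol w v := (forall delta : R, 0 < delta -> bounded_discounted_solution
    (fun p x => H p x - bump_sum zeta X w x) delta (v delta)) /\
  - (delta * v delta 0) @[delta --> 0^'+] --> c.
pose good w := (exists v, sol w v) /\ forall k, 0 <= X k w <= 1.
have aeG : \forall w \ae P, good w by exact: filterI aec aeX.
have X01 w : good w -> forall k, 0 <= X k w <= 1 by case.
have /choice[v vsol] w : exists v, good w -> sol w v.
  have [[[v sv] _]|nG] := pselect (good w); first by exists v.
  by exists (fun _ _ => 0).
apply/andP; split.
  (* For the lower bound, one good [w] suffices: [discounted_lower] passes to the limit along
     [delta]. *)
  have [w [_ Gw]] := ae_meets aeG measurableT
    (ltac:(rewrite probability_setT lte_fin; exact: ltr01)).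
  have [solw cvgw] := vsol w Gw.
  rewrite subr_ge0.
  have cvgB : Hbar + delta * (2 * B) @[delta --> 0^'+] --> Hbar + 0 * (2 * B).
    apply: cvg_at_right_filter; apply: cvgD; first exact: cvg_cst.
    by apply: cvgM; [exact: cvg_id|exact: cvg_cst].
  rewrite mul0r addr0 in cvgB.
  apply: (ler_cvg_to cvgw cvgB); near=> delta.
  have delta0 : 0 < delta by near: delta; exact: nbhs_right_gt.
  have f0 x : 0 <= bump_sum zeta X w x.
    by case/andP: (bump_sum_bound zeta_ge0 zetaZ supp X01 x Gw).
  exact: (discounted_lower jen K0 L0 lip coer chiB ZN0 chi_sol f0 delta0
    (solw _ delta0)).
rewrite leNgt; apply/negP => gap.
(* A quarter of the gap: one part for the error in [deviation], one for [delta * (2 * B)], one for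
   the level [c + e] above [c]; the last bounds the probability from below. *)
pose e := (Hbar - c - Z * N0 * eta) / 4.
have e0 : 0 < e.
  by rewrite /e divr_gt0// subr_gt0; move: eta01 gap; rewrite mulrDl; lra.
have eE : Hbar - c - Z * N0 * eta = 4 * e by rewrite /e; field.
have ZNeta : 0 <= Z * N0 * eta by rewrite mulr_ge0//; move: eta01; lra.
pose h := Num.min 1 (e / (2 * B + 1)).
have B1 : 0 < 2 * B + 1 by rewrite ltr_wpDl// mulr_ge0.
have h0 : 0 < h by rewrite lt_min ltr01 divr_gt0.
pose delta (n : nat) : R := h / n.+1%:R.
have delta_h n : delta n <= h.
  by rewrite /delta ler_pdivrMr// ler_peMr ?(ltW h0)// ler1n.
have delta0 n : 0 < delta n by rewrite divr_gt0.
have delta01 n : 0 < delta n <= 1.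
  by rewrite delta0/= (le_trans (delta_h n))// ge_min lexx.
have deltaB n : delta n * (2 * B) <= e.
  have : delta n <= e / (2 * B + 1).
    by rewrite (le_trans (delta_h n))// ge_min lexx orbT.
  by rewrite ler_pdivlMr//; have := delta0 n; lra.
have sM : c + e <= Hbar + 2 * B by lra.
have D0 : 0 < Hbar + 2 * B - (c + e) by lra.
(* The lower bound on the probability does not depend on [n], as [limsup_meets] demands. *)
have dev n : exists U, [/\ measurable U,
    ((e / (Hbar + 2 * B - (c + e)))%:E <= P U)%E &
    U `&` good `<=` [set w | c + e < - (delta n * v w (delta n) 0)]].
  have [U [q [mU PU UG Hq]]] := deviation zeta_ge0 zetaZ supp jen K0 L0 lip coer
    chiB chi_sol eta01 X_indep X1 X0 (fun U => ae_meets aeG (U := U)) X01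
    (v := fun w => v w (delta n)) (delta01 n) e0 sM
    (fun w Gw => (vsol w Gw).1 _ (delta0 n)).
  exists U; split=> //; rewrite PU lee_fin ler_pdivrMr// mulrC.
  by have := deltaB n; rewrite -/N0 in Hq; lra.
have [U HU] := choice dev.
have [|||w Gw Uw] := limsup_meets aeG (U := U)
  (q := e / (Hbar + 2 * B - (c + e))).
- by move=> n; case: (HU n).
- exact: divr_gt0.
- by move=> n; case: (HU n).
have [_ cvgw] := vsol w Gw.
have ce : c < c + e by rewrite ltrDl.
have [rho rho0 Hrho] := cvgr_lt c cvgw _ ce.
(* For such [n], [n.+1 > h / rho], hence [delta n < rho]: convergence puts the value below [c + e],
   while membership in [U n] puts it above. *)
have [n nm Un] := Uw (Num.truncn (h / rho)).
have [_ _ /(_ w (conj Un Gw)) /=] := HU n.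
apply/negP; rewrite -leNgt ltW//; apply: Hrho => //=.
rewrite sub0r normrN gtr0_norm// /delta ltr_pdivrMr// mulrC -ltr_pdivrMr//.
by rewrite (lt_le_trans (truncnS_gt _))// ler_nat ltnS.
Unshelve. all: by end_near. Qed.
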